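(* Let $T$ be a tree of order at least $6$. Then $T\in\mathcal{O}$ if and only if either $T\in\mathcal{O}'$, or there is a matching $M$ in $T$ such that every component of $T\mp M$ belongs to $\mathcal{O}'$.
   Context: For a matching $M$ in a graph $G$, $G\mp M$ denotes the graph obtained from $G-M$ (delete the edges of $M$) by attaching exactly one new pendant edge (to a new leaf) at each vertex covered by $M$. Family $\mathcal{O}$ (labeled trees, each vertex has status $A$ or $B$): it contains the path $P_6$ whose two central vertices have status $A$ and other four vertices status $B$; and it is closed under: Operation $\mathcal{O}_1$: for a path $xyz$ with $x,y$ of status $B$ and $z$ of status $A$, add a new path $abc$ and edge $za$ with statuses $a\colon A$, $b\colon B$, $c\colon B$; Operation $\mathcal{O}_2$: for an edge $xy$ with $x,y$ of status $B$, add a new path $abcd$ and edge $dx$ with statuses $a\colon B$, $b\colon B$, $c\colon A$, $d\colon A$. An unlabeled tree is in $\mathcal{O}$ if it is the underlying tree of a labeled tree in $\mathcal{O}$. $2$-subdivision: let $G$ be a connected graph of order at least $2$ and $\mathcal{P}=\{\mathcal{P}(v):v\in V(G)\}$ where $\mathcal{P}(v)$ is a partition of $N_G(v)$ (into nonempty blocks). $G(\mathcal{P})$ has vertex set $V(G)\cup(V(G)\times\{1\})\cup\bigcup_{v\in V(G)}(\{v\}\times\mathcal{P}(v))$ and edge set $E_1\cup E_2\cup E_3$, where $E_1=\{v(v,1):v\in V(G)\}$, $E_2=\{v(v,A): v\in V(G), A\in\mathcal{P}(v)\}$, and $E_3=\{(u,A)(v,B): uv\in E(G), A\in\mathcal{P}(u),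 B\in\mathcal{P}(v), v\in A, u\in B\}$. $\mathcal{O}'$ is the family of all trees isomorphic to some $R(\mathcal{P})$ where $R$ is a tree of order at least $2$ and $\mathcal{P}$ is such a family of partitions. *)

(* Defs.v *)
From mathcomp Require Import all_boot.
Set Implicit Arguments. Unset Strict Implicit. Unset Printing Implicit Defensive.

Record sgraph := SGraph { vert :> finType; adj : rel vert }.
Arguments adj : clear implicits.

Definition simple (G : sgraph) : Prop :=
  symmetric (adj G) /\ irreflexive (adj G).

Definition connected (G : sgraph) : Prop :=
  forall x y : G, connect (adj G) x y.

(* no cycle: every cycle of pairwise distinct vertices has length <= 2
   (length-2 "cycles" are just edges traversed back and forth) *)
Definition acyclic (G : sgraph) : Prop :=
  forall s : seq G, ucycle (adj G) s -> size s <= 2.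

Definition is_tree (G : sgraph) : Prop := simple G /\ connected G /\ acyclic G.

Definition iso (G H : sgraph) : Prop :=
  exists f : G -> H, bijective f /\ forall u v, adj H (f u) (f v) = adj G u v.

Definition embeds (G G' : sgraph) (f : G -> G') : Prop :=
  injective f /\ forall u v, adj G' (f u) (f v) = adj G u v.

Inductive status := SA | SB.

Inductive inO_lab : forall G : sgraph, (G -> status) -> Prop :=
| inO_base (G : sgraph) (lab : G -> status) (f : 'I_6 -> G) :
    simple G -> bijective f ->
    (forall i j : 'I_6, adj G (f i) (f j) = ((i.+1 == j) || (j.+1 == i))) ->
    (forall i : 'I_6, lab (f i) = if (i == 2 :> nat) || (i == 3 :> nat) then SA else SB) ->
    inO_lab lab
| inO_op1 (G : sgraph) (lab : G -> status) (G' : sgraph) (lab' : G' -> status)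
    (f : G -> G') (x y z : G) (a b c : G') :
    inO_lab lab -> simple G' -> embeds f ->
    adj G x y -> adj G y z -> x != z ->
    lab x = SB -> lab y = SB -> lab z = SA ->
    uniq [:: a; b; c] ->
    (forall w : G', (w \in [:: a; b; c]) = (w \notin codom f)) ->
    (forall w : G', adj G' a w = (w == b) || (w == f z)) ->
    (forall w : G', adj G' b w = (w == a) || (w == c)) ->
    (forall w : G', adj G' c w = (w == b)) ->
    (forall u : G, lab' (f u) = lab u) ->
    lab' a = SA -> lab' b = SB -> lab' c = SB ->
    inO_lab lab'
| inO_op2 (G : sgraph) (lab : G -> status) (G' : sgraph) (lab' : G' -> status)
    (f : G -> G') (x y : G) (a b c d : G') :
    inO_lab lab -> simple G' -> embeds f ->
    adj G x y -> lab x = SB -> lab y = SB ->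
    uniq [:: a; b; c; d] ->
    (forall w : G', (w \in [:: a; b; c; d]) = (w \notin codom f)) ->
    (forall w : G', adj G' a w = (w == b)) ->
    (forall w : G', adj G' b w = (w == a) || (w == c)) ->
    (forall w : G', adj G' c w = (w == b) || (w == d)) ->
    (forall w : G', adj G' d w = (w == c) || (w == f x)) ->
    (forall u : G, lab' (f u) = lab u) ->
    lab' a = SB -> lab' b = SB -> lab' c = SA -> lab' d = SA ->
    inO_lab lab'.

Definition inO (T : sgraph) : Prop := exists lab : T -> status, inO_lab lab.

Definition nbhd (G : sgraph) (v : G) : {set G} := [set u | adj G v u].

Section Subdiv.
Variables (G : sgraph) (P : G -> {set {set G}}).

Definition blockv := {p : G * {set G} | p.2 \in P p.1}.

(* inl (inl v) = v ; inl (inr v) = (v,1) ; inr p = (v,A) *)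
Definition subdiv_adj (x y : (G + G) + blockv) : bool :=
  match x, y with
  | inl (inl v), inl (inr w) => v == w
  | inl (inr w), inl (inl v) => v == w
  | inl (inl v), inr p => v == (val p).1
  | inr p, inl (inl v) => v == (val p).1
  | inr p, inr q =>
      [&& adj G (val p).1 (val q).1, (val q).1 \in (val p).2 & (val p).1 \in (val q).2]
  | _, _ => false
  end.

Definition subdiv : sgraph := SGraph subdiv_adj.
End Subdiv.

Definition inO' (T : sgraph) : Prop :=
  exists (R : sgraph) (P : R -> {set {set R}}),
    [/\ is_tree R, 2 <= #|R|, (forall v : R, partition (P v) (nbhd v)) &
        iso (subdiv P) T].

Definition matching (G : sgraph) (M : {set {set G}}) : Prop :=
  (forall e, e \in M -> exists u v, [/\ adj G u v & e = [set u; v]]) /\ trivIset M.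

Section MinusPlus.
Variables (G : sgraph) (M : {set {set G}}).

Definition covered := {v : G | v \in cover M}.

(* inl v = original vertex ; inr v = new leaf attached at covered vertex v *)
Definition mp_adj (x y : G + covered) : bool :=
  match x, y with
  | inl u, inl v => adj G u v && ([set u; v] \notin M)
  | inl u, inr w => u == val w
  | inr w, inl u => u == val w
  | inr _, inr _ => false
  end.

Definition minus_plus : sgraph := SGraph mp_adj.
End MinusPlus.

Definition induced (G : sgraph) (S : {set G}) : sgraph :=
  @SGraph {x : G | x \in S} (fun a b => adj G (val a) (val b)).

Definition component (G : sgraph) (x : G) : sgraph :=
  induced [set y | connect (adj G) x y].

(* Main.v *)
Require Import Defs.
From mathcomp Require Import all_boot.

(** Call a labelling good if every vertex has exactly one neighbour of status
    B and every A-vertex has an A-neighbour; the B-B edges then form a perfect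
    matching of the B-vertices.  Both operations preserve goodness.
    Conversely, in a good tree a longest path ending in an A-A edge z-a ends at
    a pendant path z-a-b-c with statuses A-A-B-B, and stripping a, b, c (if z
    has another A-neighbour) or a, b, c, z (otherwise) undoes one operation;
    so a tree with an A-vertex belongs to O exactly when it has a good
    labelling.
    A 2-subdivision is precisely a good tree in which every B-B edge has an
    end that is a leaf.  In an arbitrary good tree, the B-B edges with both
    ends adjacent to A-vertices form the matching M: cutting them and attaching
    leaves produces good components of this restricted kind, and re-joining
    the components along M preserves goodness, as each new leaf is forced to
    be the unique B-neighbour of the vertex carrying it. *)

(** * Bridges and paths in acyclic graphs *)

Lemma connect_homo {S T : finType} {e : rel S} {e' : rel T} (f : S -> T) :
  (forall x y, e x y -> connect e' (f x) (f y)) ->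
  forall x y, connect e x y -> connect e' (f x) (f y).
Proof.
move=> homo x y /connectP[p]; elim: p x => [|z p IHp] x /= => [_ ->|]; first exact: connect0.
by case/andP=> /homo xz zp yE; apply: connect_trans xz (IHp _ zp yE).
Qed.

Definition del_edge (G : sgraph) (x y : G) : rel G := fun u v =>
  adj G u v && ~~ (((u == x) && (v == y)) || ((u == y) && (v == x))).

Lemma del_edge_sym (G : sgraph) (x y : G) :
  symmetric (adj G) -> connect_sym (del_edge G x y).
Proof.
move=> symG; apply: sym_connect_sym => u v; rewrite /del_edge symG; congr (_ && ~~ _).
by rewrite orbC andbC; congr (_ || _); rewrite andbC.
Qed.

Lemma acyclic_bridge (G : sgraph) (x y : G) :
  simple G -> acyclic G -> adj G x y -> ~~ connect (del_edge G x y) x y.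
Proof.
move=> [symG irrG] acG xy; apply/negP => /connectP[q qP].
case/shortenP: qP => p pP up _ yE.
have pA: path (adj G) x p by apply: sub_path pP => u v /andP[].
have := acG (x :: p); rewrite /ucycle up /= rcons_path pA -yE symG xy => /(_ isT).
case: p pP yE {pA up} => [|z [|? ?]] //= pP yE.
  by rewrite yE irrG in xy.
by move: pP; rewrite -yE /del_edge !eqxx /= andbF.
Qed.

Lemma bridge_acyclic (G : sgraph) :
  symmetric (adj G) ->
  (forall x y : G, adj G x y -> ~~ connect (del_edge G x y) x y) -> acyclic G.
Proof.
move=> symG bridge [|x [|y [|z s]]] //.
rewrite /ucycle /= rcons_path !inE !negb_or.
case/andP=> /and3P[xy yz /andP[zs sx]] /and3P[/and3P[xy' xz' xs'] /andP[yz' ys'] _].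
case/negP: (bridge _ _ xy); rewrite del_edge_sym //.
have E u v : adj G u v -> u != x -> u != y -> del_edge G x y u v.
  by rewrite /del_edge => -> /negPf-> /negPf->.
apply: (@connect_trans _ _ z).
  by apply: connect1; rewrite /del_edge yz (eq_sym y x) (negPf xy') (eq_sym z x) (negPf xz') andbF.
have N u : u \in z :: s -> (u != x) && (u != y).
  rewrite inE => /orP[/eqP->|us]; first by rewrite !(eq_sym z) xz' yz'.
  by apply/andP; split; apply: contraTneq us => ->.
apply: (@connect_trans _ _ (last z s)); last first.
  by apply: connect1; case/andP: (N _ (mem_last z s)) => *; apply: E.
apply/connectP; exists s => //.
elim: s z zs {sx xs' ys' yz yz' xz'} N => //= t s IHs z /andP[zt ts] N.
rewrite E ?IHs ?zt //; first by move=> u us; apply: N; rewrite inE us orbT.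
- by case/andP: (N z (mem_head _ _)).
- by case/andP: (N z (mem_head _ _)).
Qed.

Lemma acyclic_path_extend (G : sgraph) (w a z : G) q :
  acyclic G -> path (adj G) a (z :: q) -> uniq (a :: z :: q) ->
  adj G w a -> w != a -> w != z -> uniq (w :: a :: z :: q).
Proof.
move=> acG aq uq wa wNa wNz; rewrite cons_uniq uq andbT !inE !negb_or wNa wNz /=.
apply/negP=> wq; case/splitPr: wq aq uq => q1 q2 aq uq.
have := acG (a :: z :: rcons q1 w).
rewrite /ucycle /= rcons_path last_rcons wa size_rcons.
move: aq => /= /andP[-> +]; rewrite -cat_rcons cat_path => /andP[-> _] /=.
move: uq; rewrite -cat_rcons -!cat_cons cat_uniq => /andP[+ _].
by rewrite /= => -> /(_ isT).
Qed.

(** * Good labellings *)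

(* [B] is the set of vertices of status B. *)
Definition good_at {G : sgraph} (B : pred G) (v : G) : Prop :=
  (exists w, forall u, adj G v u && B u = (u == w)) /\
  (~~ B v -> exists2 u, adj G v u & ~~ B u).

Definition good {G : sgraph} (B : pred G) : Prop := forall v, good_at B v.

Definition bnbr {G : sgraph} (B : pred G) (v : G) : G :=
  odflt v [pick w | adj G v w && B w].

Definition hasA {G : sgraph} (B : pred G) (v : G) : bool :=
  [exists u, adj G v u && ~~ B u].

Section Good.
Context {G : sgraph} {B : pred G}.
Hypotheses (sG : simple G) (gB : good B).
Notation m := (bnbr B).

Lemma bnbrE v u : adj G v u && B u = (u == m v).
Proof.
have [[w wP] _] := gB v; rewrite wP /bnbr; case: pickP => [t|/(_ w)].
  by rewrite wP => /eqP->.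
by rewrite wP eqxx.
Qed.

Lemma adj_bnbr v : adj G v (m v).
Proof. by have := bnbrE v (m v); rewrite eqxx => /andP[]. Qed.

Lemma bnbrB v : B (m v).
Proof. by have := bnbrE v (m v); rewrite eqxx => /andP[]. Qed.

Lemma bnbr_uniq v u : adj G v u -> B u -> m v = u.
Proof. by move=> vu Bu; apply/esym/eqP; rewrite -bnbrE vu. Qed.

Lemma bnbrK v : B v -> m (m v) = v.
Proof. by move=> Bv; apply: bnbr_uniq => //; rewrite sG.1 adj_bnbr. Qed.

Lemma adj_neq u v : adj G u v -> u != v.
Proof. by apply: contraTneq => ->; rewrite sG.2. Qed.

Lemma bnbr_neq v : m v != v.
Proof. by rewrite eq_sym adj_neq ?adj_bnbr. Qed.

Lemma notB_nbr v : ~~ B v -> exists2 u, adj G v u & ~~ B u.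
Proof. by case: (gB v). Qed.

Lemma B_pair_hasA v :
  connected G -> (exists a, ~~ B a) -> B v -> hasA B v || hasA B (m v).
Proof.
move=> cG [a Ba] Bv; apply: contraNT Ba; rewrite negb_or => /andP[/existsPn nv /existsPn nm].
suff: a \in pred2 v (m v) by rewrite inE => /orP[/eqP->|/eqP->]; rewrite ?bnbrB.
rewrite -(@closed_connect _ (adj G) (pred2 v (m v)) _ _ _ (cG v a)) ?inE ?eqxx //.
apply: intro_closed; first by apply: sym_connect_sym; exact: sG.1.
move=> x y xy; rewrite !inE => /orP[] /eqP xE; move: xy; rewrite xE => xy.
  by move: (nv y); rewrite xy negbK => /(bnbr_uniq _ _ xy) ->; rewrite eqxx orbT.
by move: (nm y); rewrite xy negbK => /(bnbr_uniq _ _ xy) <-; rewrite bnbrK ?eqxx.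
Qed.

End Good.

(** * Good trees whose B-B edges have a leaf end are 2-subdivisions *)

Lemma bij_of_inj_surj {S T : finType} (f : S -> T) :
  injective f -> (forall y, exists x, f x = y) -> bijective f.
Proof.
by move=> injf /fin_all_exists[g gP]; exists g => // x; apply: injf; rewrite gP.
Qed.

Section Quotient.
Context {H : sgraph} {B : pred H}.
Hypotheses (tH : is_tree H) (gB : good B).
Notation m := (bnbr B).
Let sH : simple H := tH.1.

Lemma connect_del_bnbr a b c :
  ~~ B a -> ~~ B b -> connect (del_edge H a b) c (m c).
Proof.
move=> Ba Bb; apply: connect1; rewrite /del_edge adj_bnbr //=.
have Bm := bnbrB gB c.
have N u : ~~ B u -> (m c == u) = false by apply: contraNF => /eqP<-.
by rewrite !N // !andbF.
Qed.

Lemma AA_bnbr_neq a b : ~~ B a -> ~~ B b -> adj H a b -> m a != m b.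
Proof.
move=> Ba Bb ab; apply: contraNneq (acyclic_bridge _ _ _ sH tH.2.2 ab) => mab.
apply: connect_trans (connect_del_bnbr _ _ a Ba Bb) _.
by rewrite mab del_edge_sym ?connect_del_bnbr //; exact: sH.1.
Qed.

Lemma AA_bnbr_inj a b c d :
  ~~ B a -> ~~ B b -> ~~ B c -> adj H a b -> adj H c d ->
  m a = m c -> m b = m d -> a = c /\ b = d.
Proof.
move=> Ba Bb Bc ab cd mac mbd.
have symC := del_edge_sym H a b sH.1.
have: ~~ del_edge H a b c d.
  apply: contra (acyclic_bridge _ _ _ sH tH.2.2 ab) => /connect1 cd'.
  apply: connect_trans (connect_del_bnbr _ _ a Ba Bb) _; rewrite mac symC.
  apply: connect_trans (_ : connect _ b c) (connect_del_bnbr _ _ c Ba Bb).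
  apply: connect_trans (connect_del_bnbr _ _ b Ba Bb) _; rewrite mbd symC.
  by apply: connect_trans cd' (connect_del_bnbr _ _ d Ba Bb).
rewrite /del_edge cd negbK => /orP[/andP[/eqP-> /eqP->]//|/andP[/eqP cb /eqP da]].
by case/negP: (AA_bnbr_neq _ _ Ba Bb ab); rewrite mac cb.
Qed.

(* The core is the tree [R] of the 2-subdivision: its vertices are the non-leaf
   B-vertices, joined when they have adjacent A-neighbours; an A-vertex [a] is
   the vertex [(bnbr B a, core_block a)] of the 2-subdivision. *)
Definition core_vertex := {v : H | B v && hasA B v}.

Definition core_adj (u v : core_vertex) :=
  [exists a, [exists b,
    [&& adj H a b, ~~ B a, ~~ B b, m a == val u & m b == val v]]].

Definition core : sgraph := SGraph core_adj.

Definition core_block (a : H) : {set core} :=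
  [set u : core | [exists b, [&& adj H a b, ~~ B b & m b == val u]]].

Definition core_part (v : core) : {set {set core}} :=
  [set core_block a | a in [pred a | ~~ B a && (m a == val v)]].

Lemma core_adjP (u v : core) :
  reflect (exists a b, [/\ adj H a b, ~~ B a, ~~ B b, m a = val u & m b = val v])
          (core_adj u v).
Proof.
apply: (iffP existsP) => -[a].
  by case/existsP=> b /and5P[ab Ba Bb /eqP ma /eqP mb]; exists a, b.
by case=> b [ab Ba Bb ma mb]; exists a; apply/existsP; exists b; rewrite ab Ba Bb ma mb !eqxx.
Qed.

Lemma core_blockP (a : H) (u : core) :
  reflect (exists b, [/\ adj H a b, ~~ B b & m b = val u]) (u \in core_block a).
Proof.
rewrite inE; apply: (iffP existsP) => -[b].
  by case/and3P=> ab Bb /eqP mb; exists b.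
by case=> ab Bb mb; exists b; rewrite ab Bb mb eqxx.
Qed.

Lemma core_simple : simple core.
Proof.
split=> [u v|v].
  by apply/core_adjP/core_adjP => -[a [b [ab *]]]; exists b, a; rewrite sH.1.
apply/core_adjP => -[a [b [ab Ba Bb ma mb]]].
by case/negP: (AA_bnbr_neq _ _ Ba Bb ab); rewrite ma mb.
Qed.

Lemma core_acyclic : acyclic core.
Proof.
apply: bridge_acyclic => [|u v /core_adjP[a [b [ab Ba Bb ma mb]]]].
  exact: core_simple.1.
apply: contra (acyclic_bridge _ _ _ sH tH.2.2 ab) => uv.
have symC := del_edge_sym H a b sH.1.
apply: connect_trans (connect_del_bnbr _ _ a Ba Bb) _; rewrite symC.
apply: connect_trans (connect_del_bnbr _ _ b Ba Bb) _; rewrite symC ma mb.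
apply: (connect_homo val _ _ _ uv) => s t /andP[/core_adjP[c [d [cd Bc Bd mc md]]] st].
rewrite -mc -md symC; apply: connect_trans (_ : connect _ _ c) (connect_del_bnbr _ _ _ Ba Bb).
rewrite symC; apply: connect_trans (_ : connect _ c d) (connect_del_bnbr _ _ _ Ba Bb).
apply: connect1; rewrite /del_edge cd; apply: contra st.
case/orP=> /andP[/eqP cE /eqP dE]; move: mc md; rewrite cE dE ?ma ?mb;
  by move=> /val_inj<- /val_inj<-; rewrite !eqxx ?orbT.
Qed.

Lemma core_partition (v : core) : partition (core_part v) (nbhd v).
Proof.
apply/and3P; split.
- apply/eqP/setP => u; rewrite inE; apply/bigcupP/core_adjP => [[_ /imsetP[a aP ->]]|].
    move: aP; rewrite inE => /andP[Ba /eqP ma] /core_blockP[b [ab Bb mb]].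
    by exists a, b.
  case=> a [b [ab Ba Bb ma mb]]; exists (core_block a); last by apply/core_blockP; exists b.
  by apply/imsetP; exists a; rewrite // inE Ba ma eqxx.
- apply/trivIsetP => _ _ /imsetP[a aP ->] /imsetP[c cP ->] ac.
  rewrite -setI_eq0; apply: contraNT ac => /set0Pn[u] /setIP[].
  case/core_blockP=> b [ab Bb mb] /core_blockP[d [cd Bd md]].
  move: aP cP; rewrite !inE => /andP[Ba /eqP ma] /andP[Bc /eqP mc].
  by have [->] := AA_bnbr_inj _ _ _ _ Ba Bb Bc ab cd (etrans ma (esym mc)) (etrans mb (esym md)).
- apply/imsetP => -[a]; rewrite inE => /andP[Ba /eqP ma] /esym/setP E.
  have [b ab Bb] := notB_nbr gB a Ba.
  have mb: B (m b) && hasA B (m b).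
    by rewrite bnbrB //=; apply/existsP; exists b; rewrite sH.1 adj_bnbr.
  by have := E (Sub (m b) mb); rewrite in_set0 => /idP[]; apply/core_blockP; exists b.
Qed.

Lemma core_block_inj a c : ~~ B a -> ~~ B c -> m a = m c -> core_block a = core_block c -> a = c.
Proof.
move=> Ba Bc mac E; have [b ab Bb] := notB_nbr gB a Ba.
have mb: B (m b) && hasA B (m b).
  by rewrite bnbrB //=; apply/existsP; exists b; rewrite sH.1 adj_bnbr.
have: (Sub (m b) mb : core) \in core_block a by apply/core_blockP; exists b.
rewrite E => /core_blockP[d [cd Bd md]].
by have [] := AA_bnbr_inj _ _ _ _ Ba Bb Bc ab cd mac (esym md).
Qed.

Hypothesis leafB : forall v, B v -> hasA B v -> ~~ hasA B (m v).
Hypothesis exA : exists a, ~~ B a.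

Lemma hasA_bnbr a : ~~ B a -> hasA B (m a).
Proof. by move=> Ba; apply/existsP; exists a; rewrite sH.1 adj_bnbr. Qed.

Lemma core_connected : connected core.
Proof.
have rE (v : H) : exists u : core, val u = if B v && hasA B v then v else m v.
  case: ifPn => [Bv|]; first by exists (Sub v Bv).
  rewrite negb_and => vN.
  have Bm : B (m v) && hasA B (m v).
    rewrite bnbrB //=; case: (boolP (B v)) vN => [Bv /= nv|Bv _]; last exact: hasA_bnbr.
    by have := B_pair_hasA sH gB v tH.2.1 exA Bv; rewrite (negPf nv).
  by exists (Sub (m v) Bm).
have [r rP] := fin_all_exists rE; move=> u v.
have rK w : r (val w) = w by apply: val_inj; rewrite rP (valP w).
rewrite -(rK u) -(rK v).
apply: connect_homo (tH.2.1 (val u) (val v)) => x y xy.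
have BA w t : B w -> ~~ B t -> adj H w t -> r w = r t.
  move=> Bw Bt wt; have mt : m t = w by apply: bnbr_uniq; rewrite // sH.1.
  by apply: val_inj; rewrite !rP (negPf Bt) mt Bw -mt hasA_bnbr.
case: (boolP (B x)) (boolP (B y)) => [Bx|Bx] [By|By].
- have mx : m x = y by apply: bnbr_uniq.
  suff -> : r x = r y by [].
  apply: val_inj; rewrite !rP Bx By /= -mx bnbrK //.
  case: ifPn => nx; first by rewrite (negPf (leafB _ Bx nx)).
  by have := B_pair_hasA sH gB x tH.2.1 exA Bx; rewrite (negPf nx) /= => ->.
- by rewrite (BA _ _ Bx By xy).
- by rewrite (BA y x) // sH.1.
- apply: connect1; apply/core_adjP; exists x, y.
  by rewrite !rP (negPf Bx) (negPf By).
Qed.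

Lemma core_card : 2 <= #|core|.
Proof.
have [a Ba] := exA; have [b ab Bb] := notB_nbr gB a Ba.
have C c : ~~ B c -> B (m c) && hasA B (m c) by move=> Bc; rewrite bnbrB ?hasA_bnbr.
have N : (Sub (m a) (C a Ba) : core) != Sub (m b) (C b Bb).
  by rewrite -val_eqE /=; apply: AA_bnbr_neq.
by have := max_card [set (Sub (m a) (C a Ba) : core); Sub (m b) (C b Bb)]; rewrite cards2 N.
Qed.

Lemma core_iso : iso (subdiv core_part) H.
Proof.
have gE (p : blockv core_part) : exists a,
    [/\ ~~ B a, m a = val (val p).1 & core_block a = (val p).2].
  case: p => -[v A] /= /imsetP[a].
  by rewrite inE => /andP[Ba /eqP ma] ->; exists a.
have [g gP] := fin_all_exists gE.
have Bc (v : core) : B (val v) by case/andP: (valP v).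
have Nc (v w : core) : val v != m (val w).
  apply: contraTneq (valP v) => ->; rewrite negb_and leafB ?orbT //.
  by case/andP: (valP w).
have mI (v w : core) : (m (val v) == m (val w)) = (v == w).
  apply/eqP/eqP => [E|->//]; apply: val_inj.
  by rewrite -(bnbrK sH gB _ (Bc v)) E bnbrK.
pose f (x : subdiv core_part) := match x with
  inl (inl v) => val v | inl (inr v) => m (val v) | inr p => g p end.
have BB (u v : H) : B v -> adj H u v = (m u == v).
  by move=> Bv; have := bnbrE gB u v; rewrite Bv andbT eq_sym.
exists f; split.
  apply: bij_of_inj_surj => [|y].
  - have NB (u v : H) : B u -> ~~ B v -> u <> v by move=> + + uv; rewrite uv => ->.
    move=> [[v|v]|p] [[w|w]|q] /= E.
    + by rewrite (val_inj E).
    + by case/eqP: (Nc v w).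
    + by case: (gP q) => Bq _ _; case: (NB _ _ (Bc v) Bq).
    + by case/eqP: (Nc w v).
    + by congr (inl (inr _)); apply/eqP; rewrite -?mI E eqxx.
    + by case: (gP q) => Bq _ _; case: (NB _ _ (bnbrB gB (val v)) Bq).
    + by case: (gP p) => Bp _ _; case: (NB _ _ (Bc w) Bp).
    + by case: (gP p) => Bp _ _; case: (NB _ _ (bnbrB gB (val w)) Bp).
    + congr (inr _); apply: val_inj; case: (gP p) (gP q) => [_ p1 p2] [_ q1 q2].
      rewrite (surjective_pairing (val p)) (surjective_pairing (val q)).
      by rewrite -p2 -q2 E (val_inj (etrans (esym p1) (etrans (congr1 _ E) q1))).
  - case: (boolP (B y)) => By.
      case: (boolP (hasA B y)) => yA.
        by exists (inl (inl (Sub y (introT andP (conj By yA))))).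
      have Bm : B (m y) && hasA B (m y).
        by rewrite bnbrB //=; have := B_pair_hasA sH gB y tH.2.1 exA By; rewrite (negPf yA).
      by exists (inl (inr (Sub (m y) Bm))); rewrite /= bnbrK.
    have Bm : B (m y) && hasA B (m y) by rewrite bnbrB ?hasA_bnbr.
    have yP : core_block y \in core_part (Sub (m y) Bm).
      by apply/imsetP; exists y; rewrite // inE By /= eqxx.
    pose p : blockv core_part := Sub (Sub (m y) Bm, core_block y) yP.
    exists (inr p); case: (gP p) => Bp mp bp.
    by apply: core_block_inj.
move=> [[v|v]|p] [[w|w]|q].
- by change (adj H (val v) (val w) = false); rewrite BB //; apply/negbTE; rewrite eq_sym Nc.
- by change (adj H (val v) (m (val w)) = (v == w)); rewrite BB ?bnbrB // mI.
- change (adj H (val v) (g q) = (v == (val q).1)).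
  by case: (gP q) => _ mq _; rewrite sH.1 BB // mq eq_sym.
- by change (adj H (m (val v)) (val w) = (w == v)); rewrite BB // bnbrK // eq_sym.
- change (adj H (m (val v)) (m (val w)) = false).
  by rewrite BB ?bnbrB // bnbrK //; apply/negbTE.
- change (adj H (m (val v)) (g q) = false).
  by case: (gP q) => _ mq _; rewrite sH.1 BB ?bnbrB // mq; apply/negbTE.
- change (adj H (g p) (val w) = (w == (val p).1)).
  by case: (gP p) => _ mp _; rewrite BB // mp eq_sym.
- change (adj H (g p) (m (val w)) = false).
  by case: (gP p) => _ mp _; rewrite BB ?bnbrB // mp; apply/negbTE.
change (adj H (g p) (g q) = [&& core_adj (val p).1 (val q).1,
  (val q).1 \in (val p).2 & (val p).1 \in (val q).2]).
case: (gP p) (gP q) => [Bp p1 p2] [Bq q1 q2].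
apply/idP/and3P => [ab|[_]].
  split; first by apply/core_adjP; exists (g p), (g q).
    by rewrite -p2; apply/core_blockP; exists (g q).
  by rewrite -q2; apply/core_blockP; exists (g p); rewrite sH.1.
rewrite -p2 -q2 => /core_blockP[b [pb Bb mb]] /core_blockP[d [qd Bd md]].
have [|||] := AA_bnbr_inj _ _ d (g q) Bp Bb Bd pb; first by rewrite sH.1.
- by rewrite p1 md.
- by rewrite mb q1.
by move=> _ bq; rewrite -bq.
Qed.

Lemma inO'_of_good : inO' H.
Proof.
exists core, core_part; split.
- by split; [exact: core_simple | split; [exact: core_connected | exact: core_acyclic]].
- exact: core_card.
- exact: core_partition.
- exact: core_iso.
Qed.

End Quotient.

(** * Transferring good labellings *)

Lemma good_iso {G H : sgraph} (f : G -> H) (B : pred G) (B' : pred H) :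
  bijective f -> (forall u v, adj H (f u) (f v) = adj G u v) ->
  (forall v, B' (f v) = B v) -> good B -> good B'.
Proof.
move=> [g fK gK] fadj fB gB v; rewrite -(gK v).
have [[w wP] A] := gB (g v); split.
  by exists (f w) => u; rewrite -(gK u) fadj fB wP (can_eq fK).
by rewrite fB => /A[u vu Bu]; exists (f u); rewrite ?fadj ?fB.
Qed.

Lemma subdiv_good {G : sgraph} (P : G -> {set {set G}}) :
  simple G -> (forall v, partition (P v) (nbhd v)) ->
  good (fun x : subdiv P => if x is inl _ then true else false).
Proof.
move=> sG pP [[v|v]|p]; split=> //.
- by exists (inl (inr v)) => -[[w|w]|q]; rewrite /= ?andbF ?andbT ?eqE //= eq_sym.
- by exists (inl (inl v)) => -[[w|w]|q]; rewrite /= ?andbF ?andbT ?eqE.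
- by exists (inl (inl (val p).1)) => -[[w|w]|q]; rewrite /= ?andbF ?andbT ?eqE.
move=> _; case: p => -[v A] /= PA.
have block u w : adj G u w -> exists2 X, X \in P u & w \in X.
  move=> uw; case/and3P: (pP u) => /eqP covP _ _.
  have : w \in cover (P u) by rewrite covP inE.
  by case/bigcupP => X; exists X.
case/and3P: (pP v) => /eqP covP _ P0.
have /set0Pn[w wA] : A != set0 by apply: contraNneq P0 => <-.
have vw : adj G v w.
  have : w \in cover (P v) by apply/bigcupP; exists A.
  by rewrite covP inE.
have [|X Xw vX] := block w v; first by rewrite sG.1.
by exists (inr (exist (fun p : G * {set G} => p.2 \in P p.1) (w, X) Xw)); rewrite //= vw wA vX.
Qed.

Lemma inO'_good {H : sgraph} : inO' H -> exists B : pred H, good B.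
Proof.
case=> R [P [tR _ pP [f [bf fadj]]]]; case: (bf) => g fK gK.
pose B (x : subdiv P) := if x is inl _ then true else false.
exists (fun v => B (g v)); apply: (good_iso f B) => // [v|]; first by rewrite fK.
exact: subdiv_good tR.1 pP.
Qed.

Section Induced.
Context {G : sgraph} (S : {set G}).

Lemma induced_simple : simple G -> simple (induced S).
Proof. by case=> symG irrG; split=> [u v|u]; [exact: symG | exact: irrG]. Qed.

Lemma induced_acyclic : acyclic G -> acyclic (induced S).
Proof.
move=> acG s /andP[cs us]; rewrite -(size_map val); apply: acG.
rewrite /ucycle map_inj_uniq ?us ?andbT; last exact: val_inj.
by case: s cs {us} => //= a s; rewrite -map_rcons path_map.
Qed.

Lemma induced_connected (r : G -> G) :
  {in S &, forall u v, connect (adj G) u v} -> (forall v, r v \in S) ->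
  (forall v, v \in S -> r v = v) ->
  (forall u v, adj G u v -> r u = r v \/ adj G (r u) (r v)) ->
  connected (induced S).
Proof.
move=> cG rS rK radj u v.
have rI (w : induced S) : Sub (r (val w)) (rS (val w)) = w.
  by apply: val_inj; apply: rK (valP w).
rewrite -(rI u) -(rI v).
apply: (connect_homo (fun w => Sub (r w) (rS w) : induced S) _ _ _ (cG _ _ (valP u) (valP v))).
move=> x y /radj[E|xy]; last exact: connect1.
by rewrite (_ : Sub (r x) _ = Sub (r y) (rS y)) //; apply: val_inj.
Qed.

Lemma induced_good (B : pred G) :
  good B -> (forall v, v \in S -> bnbr B v \in S) ->
  (forall v, v \in S -> ~~ B v -> exists u, [/\ u \in S, adj G v u & ~~ B u]) ->
  good (fun v : induced S => B (val v)).
Proof.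
move=> gB Sm SA v; split.
  exists (Sub (bnbr B (val v)) (Sm _ (valP v))) => u.
  by rewrite -[adj _ _ _]/(adj G (val v) (val u)) bnbrE // -val_eqE.
by case/(SA _ (valP v)) => u [uS vu Bu]; exists (Sub u uS).
Qed.

End Induced.

Section Component.
Context {G : sgraph} (x : G).
Hypothesis sG : simple G.
Let S := [set y | connect (adj G) x y].

Lemma component_closed u v : adj G u v -> (u \in S) = (v \in S).
Proof.
move=> uv; rewrite !inE; apply/idP/idP => xu; apply: connect_trans xu (connect1 _) => //.
by rewrite sG.1.
Qed.

Lemma component_tree : acyclic G -> is_tree (component x).
Proof.
move=> acG; split; first exact: induced_simple.
split; last exact: induced_acyclic.
have xS : x \in S by rewrite inE connect0.
apply: (@induced_connected _ _ (fun w => if w \in S then w else x)) => [u v|v|v ->|u v uv] //.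
- rewrite !inE => xu; apply: connect_trans.
  by rewrite (sym_connect_sym sG.1).
- by case: ifP.
- by rewrite (component_closed _ _ uv); case: ifP => _; [right | left].
Qed.

Lemma component_good (B : pred G) :
  good B -> good (fun v : component x => B (val v)).
Proof.
move=> gB; apply: induced_good => // v vS; first by rewrite -(component_closed _ _ (adj_bnbr gB v)).
by case/(notB_nbr gB) => u vu Bu; exists u; rewrite -(component_closed _ _ vu).
Qed.

Lemma good_at_component (B : pred (component x)) v :
  v \in S -> good B -> good_at (fun w => if insub w is Some w' then B w' else false) v.
Proof.
move=> vS gB; pose v' : component x := Sub v vS.
have D (u : component x) : insub (val u) = Some u by exact: valK.
have [[w wP] A] := gB v'; split.
  exists (val w) => u; case: (boolP (u \in S)) => uS.
    have := wP (Sub u uS).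
    by rewrite -[in insub u](@SubK _ _ (component x) u uS) D -val_eqE /= => <-.
  have -> : adj G v u = false by apply: contraNF uS => /component_closed <-.
  by apply/esym; apply: contraNF uS => /eqP->; exact: (valP w).
rewrite -[v]/(val v') D => /A[u vu Bu]; exists (val u) => //.
by rewrite D.
Qed.

End Component.

Lemma good_of_components {G : sgraph} :
  simple G -> (forall x : G, inO' (component x)) -> exists B : pred G, good B.
Proof.
move=> sG cO.
have E (x : G) : exists D : pred G, forall v, connect (adj G) x v -> good_at D v.
  have [B gB] := inO'_good (cO x).
  exists (fun w => if insub w is Some w' then B w' else false) => v xv.
  by apply: good_at_component; rewrite ?inE.
have [D DP] := fin_all_exists E.
have symC : connect_sym (adj G) by apply: sym_connect_sym; exact: sG.1.
exists (fun v => D (root (adj G) v) v) => v.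
have R u : adj G v u -> root (adj G) u = root (adj G) v.
  by move=> vu; apply/esym/rootP; rewrite // connect1.
have [|[w wP] A] := DP (root (adj G) v) v; first by rewrite symC connect_root.
split.
  by exists w => u; rewrite -wP; case vu: (adj G v u) => //=; rewrite R.
by case/A=> u vu Du; exists u; rewrite // R.
Qed.

Section MinusPlusFacts.
Context {G : sgraph} (M : {set {set G}}).
Hypothesis sG : simple G.

Lemma minus_plus_simple : simple (minus_plus M).
Proof.
split=> [[u|u] [v|v]|[u|u]] //=; last by rewrite sG.2.
by rewrite sG.1 setUC.
Qed.

Lemma mp_adj_inl (u v : G) : u \notin cover M -> adj (minus_plus M) (inl u) (inl v) = adj G u v.
Proof.
move=> uM; rewrite /= (_ : [set u; v] \notin M) ?andbT //.
by apply: contra uM => uvM; apply/bigcupP; exists [set u; v]; rewrite // !inE eqxx.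
Qed.

Lemma good_minus_plus (D : pred (minus_plus M)) :
  matching M -> good D -> good (fun v : G => D (inl v)).
Proof.
move=> [mM tM] gD.
have leafD (u : covered M) : D (inr u) /\ D (inl (val u)).
  have nbr (t : minus_plus M) : adj (minus_plus M) (inr u) t -> t = inl (val u).
    by case: t => [t /eqP->|].
  split; last by have := bnbrB gD (inr u); rewrite (nbr _ (adj_bnbr gD (inr u))).
  apply/negPn/negP => /(notB_nbr gD)[t /nbr->].
  by have := bnbrB gD (inr u); rewrite (nbr _ (adj_bnbr gD (inr u))) => ->.
move=> v; case: (boolP (v \in cover M)) => vM; last first.
  split.
    have := bnbrE gD (inl v); case: (bnbr D (inl v)) => [w|w] wP.
      by exists w => u; have := wP (inl u); rewrite mp_adj_inl.
    have := wP (inr w); rewrite eqxx => /andP[/eqP vw _].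
    by case/negP: vM; rewrite vw (valP w).
  case/(notB_nbr gD) => -[u|u] /=; first by case/andP=> *; exists u.
  by move=> /eqP vu; case/negP: vM; rewrite vu (valP u).
pose v' : covered M := Sub v vM.
have [Dv' Dv] := leafD v'.
split; last by move=> nD; rewrite -[v]/(val v') Dv in nD.
case/bigcupP: (vM) => e eM ve; have [w [vw eE]] : exists w, adj G v w /\ e = [set v; w].
  have [a [b [ab eE]]] := mM e eM; move: ve; rewrite eE !inE => /orP[]/eqP->.
    by exists b.
  by exists a; rewrite sG.1 setUC.
exists w => u; apply/andP/eqP => [[vu Du]|->].
  case: (boolP ([set v; u] \in M)) => uM.
    have : [set v; u] = e.
      apply/eqP; apply: contraTT isT => ne.
      by have /trivIsetP/(_ _ _ uM eM ne) := tM; rewrite disjoint_sym disjoints_subset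
        => /subsetP/(_ v ve); rewrite !inE eqxx.
    rewrite eE => /setP/(_ u); rewrite !inE eqxx orbT => /esym/orP[/eqP uv|/eqP //].
    by move: vu; rewrite uv sG.2.
  have := bnbr_uniq gD (inl v) (inl u); rewrite /= vu uM => /(_ isT Du).
  by have := bnbr_uniq gD (inl v) (inr v'); rewrite /= eqxx => /(_ isT Dv') ->.
split=> //.
have wM : w \in cover M by apply/bigcupP; exists e; rewrite // eE !inE eqxx orbT.
by have [] := leafD (Sub w wM).
Qed.

End MinusPlusFacts.

(** * Cutting a good tree into 2-subdivisions *)

Lemma exists_notB {G : sgraph} (B : pred G) :
  simple G -> connected G -> good B -> 2 < #|G| -> exists a, ~~ B a.
Proof.
move=> sG cG gB G2; apply/existsP; apply: contraTT G2 => /existsPn nB.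
have {}nB v : B v by apply/negPn.
rewrite -leqNgt; case: (pickP (mem G)) => [v _|G0]; last by rewrite eq_card0.
have sub : G \subset [set v; bnbr B v].
  apply/subsetP => u _.
  rewrite -(@closed_connect _ (adj G) [set v; bnbr B v] _ _ _ (cG v u)) ?inE ?eqxx //.
  apply: intro_closed; first by apply: sym_connect_sym; exact: sG.1.
  move=> x y /(bnbr_uniq gB)/(_ (nB y)) <-; rewrite !inE => /orP[]/eqP->.
    by rewrite eqxx orbT.
  by rewrite bnbrK ?eqxx.
by apply: leq_trans (subset_leq_card sub) _; rewrite cards2; case: (_ != _).
Qed.

Lemma minus_plus_acyclic {G : sgraph} (M : {set {set G}}) :
  simple G -> acyclic G -> acyclic (minus_plus M).
Proof.
move=> sG acG; have smp := minus_plus_simple M sG.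
have leaf (u : G) (w : covered M) :
    ~~ connect (del_edge (minus_plus M) (inl u) (inr w)) (inl u) (inr w)
    || ~~ adj (minus_plus M) (inl u) (inr w).
  case: (boolP (adj _ _ _)) => [uw|]; last by rewrite orbT.
  rewrite orbF del_edge_sym; last exact: smp.1.
  apply/negP => /connectP[[|t p] //=]; rewrite /del_edge; case: t => [t|//] /=.
  move: uw => /= /eqP->; case/andP=> /andP[/eqP->].
  by rewrite !eqxx /= ?orbT.
apply: bridge_acyclic smp.1 _ => -[u|u] [v|v] uv //.
- have /andP[uv' _] := uv; apply: contra (acyclic_bridge _ _ _ sG acG uv') => c.
  pose f (t : minus_plus M) : G := match t with inl v => v | inr v => val v end.
  apply: (connect_homo f _ _ _ c) => -[s|s] [t|t] /andP[//= st N].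
  + by apply: connect1; rewrite /del_edge; case/andP: st => ->.
  + by move/eqP: st => ->.
  + by move/eqP: st => ->.
- by have := leaf u v; rewrite uv orbF.
- have := leaf v u; rewrite smp.1 uv orbF; apply: contra.
  rewrite [connect (del_edge _ _ _) _ _]del_edge_sym; last exact: smp.1.
  by congr is_true; apply: eq_connect => s t; rewrite /del_edge orbC.
Qed.

Section Split.
Context {T : sgraph} {B : pred T}.
Hypotheses (tT : is_tree T) (gB : good B) (T2 : 2 < #|T|).
Notation m := (bnbr B).
Let sT : simple T := tT.1.

Definition inner_B : pred T := [pred v | [&& B v, hasA B v & hasA B (m v)]].
Definition inner_matching : {set {set T}} := [set [set v; m v] | v in inner_B].
Notation M := inner_matching.

Lemma inner_B_bnbr v : inner_B v -> inner_B (m v).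
Proof. by case/and3P=> Bv h1 h2; apply/and3P; rewrite bnbrB // bnbrK. Qed.

Lemma mem_inner_matching v e : e \in M -> v \in e -> inner_B v /\ e = [set v; m v].
Proof.
case/imsetP=> w wI ->; rewrite !inE => /orP[]/eqP-> //.
have Bw : B w by case/and3P: wI.
by split; [exact: inner_B_bnbr | rewrite bnbrK // setUC].
Qed.

Lemma cover_inner_matching v : (v \in cover M) = inner_B v.
Proof.
apply/bigcupP/idP => [[e eM /(mem_inner_matching _ _ eM)[]]//|vI].
by exists [set v; m v]; [apply/imsetP; exists v | rewrite !inE eqxx].
Qed.

Lemma matching_inner_matching : matching M.
Proof.
split=> [e /imsetP[v _ ->]|]; first by exists v, (m v); rewrite adj_bnbr.
apply/trivIsetP => e e' eM e'M; apply: contraR => /pred0Pn[v /andP[/= ve ve']].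
have [_ ->] := mem_inner_matching _ _ eM ve.
by have [_ ->] := mem_inner_matching _ _ e'M ve'.
Qed.

Definition split_B (x : minus_plus M) : bool := if x is inl v then B v else true.

Lemma split_B_good : good split_B.
Proof.
move=> [v|w]; last first.
  split=> //; exists (inl (val w)) => -[u|u]; last by [].
  rewrite (_ : (_ == inl _) = (u == val w)) //= andb_idr // => /eqP->.
  by have := valP w; rewrite cover_inner_matching => /and3P[].
case: (boolP (v \in cover M)) => vM; last first.
  split=> [|/(notB_nbr gB)[u vu Bu]]; last by exists (inl u); rewrite ?mp_adj_inl.
  exists (inl (m v)) => -[u|u]; first by rewrite mp_adj_inl // bnbrE.
  by rewrite /= andbT [RHS](_ : _ = false) //; apply: contraNF vM => /eqP->; exact: (valP u).
have vI := vM; rewrite cover_inner_matching in vI.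
split=> [|/=]; last by case/and3P: vI => ->.
exists (inr (Sub v vM)) => -[u|u]; last first.
  by rewrite (_ : (_ == inr _) = (u == Sub v vM)) //= andbT -val_eqE eq_sym.
rewrite /= [RHS](_ : _ = false) //.
apply/negbTE; rewrite -andbA andbCA; apply/negP => /and3P[uM vu Bu].
case/negP: uM; rewrite -(bnbr_uniq gB _ _ vu Bu).
by apply/imsetP; exists v.
Qed.

Lemma split_hasA v : hasA split_B (inl v) -> hasA B v.
Proof.
case/existsP=> -[u|u] /=; last by rewrite andbF.
by case/andP=> /andP[vu _] Bu; apply/existsP; exists u; rewrite vu.
Qed.

Lemma split_hasA_leaf w : ~~ hasA split_B (inr w).
Proof.
apply/existsP => -[[u|u]] //= /andP[/eqP->].
by have := valP w; rewrite cover_inner_matching => /and3P[->].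
Qed.

Lemma split_B_end x :
  split_B x -> hasA split_B x -> ~~ hasA split_B (bnbr split_B x).
Proof.
case: x => [v|w _]; last by rewrite (negPf (split_hasA_leaf w)).
move=> Bv /split_hasA Av; case: (boolP (v \in cover M)) => vM.
  by rewrite (bnbr_uniq split_B_good _ (inr (Sub v vM))) //= split_hasA_leaf.
rewrite (bnbr_uniq split_B_good _ (inl (m v))) //; last 2 first.
- by rewrite mp_adj_inl ?adj_bnbr.
- exact: bnbrB.
apply: contra vM => /split_hasA Am.
by rewrite cover_inner_matching; apply/and3P.
Qed.

Lemma split_reach_notB (x : minus_plus M) :
  exists a, connect (adj (minus_plus M)) x a /\ ~~ split_B a.
Proof.
have R v : hasA B v -> exists a, connect (adj (minus_plus M)) (inl v) a /\ ~~ split_B a.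
  case/existsP=> a /andP[va Ba]; exists (inl a); split=> //; apply: connect1.
  rewrite (minus_plus_simple M sT).1 mp_adj_inl; first by rewrite sT.1.
  by rewrite cover_inner_matching /inner_B /= (negPf Ba).
case: x => [v|w]; last first.
  have := valP w; rewrite cover_inner_matching => /and3P[_ /R[a [wa Ba]] _].
  by exists a; split=> //; apply: connect_trans (connect1 _) wa; rewrite /= eqxx.
case: (boolP (B v)) => Bv; last by exists (inl v).
case: (boolP (hasA B v)) => [/R //|nv].
have := B_pair_hasA sT gB v tT.2.1 (exists_notB _ sT tT.2.1 gB T2) Bv.
rewrite (negPf nv) /= => /R[a [wa Ba]].
exists a; split=> //; apply: connect_trans (connect1 _) wa.
rewrite mp_adj_inl ?adj_bnbr // cover_inner_matching.
by rewrite /inner_B /= (negPf nv) andbF.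
Qed.

Lemma component_split_inO' (x : minus_plus M) : inO' (component x).
Proof.
have smp := minus_plus_simple M sT.
have gC := component_good x smp _ split_B_good.
have tC := component_tree x smp (minus_plus_acyclic M sT tT.2.2).
apply: (inO'_of_good tC gC).
- have sub (u : component x) :
      hasA (fun v : component x => split_B (val v)) u -> hasA split_B (val u).
    by case/existsP=> t ut; apply/existsP; exists (val t).
  move=> v Bv /sub Av; apply: contra (split_B_end _ Bv Av) => /sub.
  by rewrite (bnbr_uniq split_B_good (val v) _ (adj_bnbr gC v) (bnbrB gC v)).
- have [a [xa Ba]] := split_reach_notB x.
  have aS : a \in [set y | connect (adj (minus_plus M)) x y] by rewrite inE.
  by exists (Sub a aS).
Qed.

End Split.

(** * Good trees are the trees of the family O *)

Definition isB (s : status) : bool := if s is SB then true else false.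

Definition P6 : sgraph := SGraph (fun i j : 'I_6 => (i.+1 == j) || (j.+1 == i)).

Lemma P6_good : good (fun i : P6 => ~~ ((i == 2 :> nat) || (i == 3 :> nat))).
Proof.
pose o k (lt : k < 6) : P6 := Ordinal lt.
move=> [[|[|[|[|[|[|//]]]]]] lti]; split=> //=.
- by exists (o 1 isT) => -[[|[|[|[|[|[|//]]]]]] ltj].
- by exists (o 0 isT) => -[[|[|[|[|[|[|//]]]]]] ltj].
- by exists (o 1 isT) => -[[|[|[|[|[|[|//]]]]]] ltj].
- by exists (o 3 isT).
- by exists (o 4 isT) => -[[|[|[|[|[|[|//]]]]]] ltj].
- by exists (o 2 isT).
- by exists (o 5 isT) => -[[|[|[|[|[|[|//]]]]]] ltj].
- by exists (o 4 isT) => -[[|[|[|[|[|[|//]]]]]] ltj].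
Qed.

Lemma good_at_extension {G G' : sgraph} (B : pred G) (B' : pred G') (f : G -> G') u :
  embeds f -> (forall v, B' (f v) = B v) ->
  (forall t, t \notin codom f -> adj G' (f u) t -> ~~ B' t) ->
  good_at B u -> good_at B' (f u).
Proof.
move=> [injf fadj] fB new [[w wP] A]; split.
  exists (f w) => t; case: (boolP (t \in codom f)) => [/codomP[t' ->]|tf].
    by rewrite fadj fB wP (inj_eq injf).
  rewrite [RHS](_ : _ = false); last by apply: contraNF tf => /eqP->; exact: codom_f.
  by case ut: (adj G' (f u) t) => //=; apply/negbTE/new.
by rewrite fB => /A[t ut Bt]; exists (f t); rewrite ?fadj ?fB.
Qed.

Lemma inO_lab_good (G : sgraph) (lab : G -> status) :
  inO_lab lab -> good (fun v => isB (lab v)).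
Proof.
elim=> {G lab}.
- move=> G lab f _ bf fadj fl; apply: (@good_iso P6 G f _ _ bf fadj _ P6_good) => v.
  by rewrite fl; case: (_ || _).
- move=> G lab G' lab' f x y z a b c _ IH [symG' irrG'] emb xy yz xz lx ly lz
    u3 cod Na Nb Nc fl la lb lc v.
  have N w t : t \in [:: a; b; c] -> (t == f w) = false.
    by rewrite cod; apply: contraNF => /eqP->; exact: codom_f.
  case: (boolP (v \in codom f)) => [/codomP[w ->]|].
    apply: good_at_extension emb _ _ (IH w) => [t|t]; first by rewrite fl.
    rewrite -cod !inE => /or3P[]/eqP->; rewrite ?la // symG' ?Nb ?Nc.
      by rewrite !(eq_sym (f w)) !N ?inE ?eqxx ?orbT.
    by rewrite !(eq_sym (f w)) !N ?inE ?eqxx ?orbT.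
  rewrite -cod !inE => /or3P[]/eqP->; split; rewrite ?la ?lb ?lc //.
  + exists b => t; rewrite Na; case: eqP => [->|_] /=; first by rewrite lb.
    by case: eqP => // ->; rewrite fl lz.
  + by exists (f z); rewrite ?Na ?eqxx ?orbT // fl lz.
  + exists c => t; rewrite Nb orbC; case: eqP => [->|_] /=; first by rewrite lc.
    by case: eqP => // ->; rewrite la.
  + by exists b => t; rewrite Nc; case: eqP => // ->; rewrite lb.
move=> G lab G' lab' f x y a b c d _ IH [symG' irrG'] emb xy lx ly
  u4 cod Na Nb Nc Nd fl la lb lc ld v.
have N w t : t \in [:: a; b; c; d] -> (t == f w) = false.
  by rewrite cod; apply: contraNF => /eqP->; exact: codom_f.
case: (boolP (v \in codom f)) => [/codomP[w ->]|].
  apply: good_at_extension emb _ _ (IH w) => [t|t]; first by rewrite fl.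
  rewrite -cod !inE => /or4P[]/eqP->; rewrite ?lc ?ld // symG' ?Na ?Nb.
    by rewrite !(eq_sym (f w)) !N ?inE ?eqxx ?orbT.
  by rewrite !(eq_sym (f w)) !N ?inE ?eqxx ?orbT.
rewrite -cod !inE => /or4P[]/eqP->; split; rewrite ?la ?lb ?lc ?ld //.
- by exists b => t; rewrite Na; case: eqP => // ->; rewrite lb.
- exists a => t; rewrite Nb; case: eqP => [->|_] /=; first by rewrite la.
  by case: eqP => // ->; rewrite lc.
- exists b => t; rewrite Nc; case: eqP => [->|_] /=; first by rewrite lb.
  by case: eqP => // ->; rewrite ld.
- by exists d; rewrite ?Nc ?eqxx ?orbT // ld.
- exists (f x) => t; rewrite Nd orbC; case: eqP => [->|_] /=; first by rewrite fl lx.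
  by case: eqP => // ->; rewrite lc.
- by exists c; rewrite ?Nd ?eqxx // lc.
Qed.

(* The path [z], [a], [bnbr B a], [bnbr B (bnbr B a)] is attached to the rest of
   the graph through [z] only (see [pendant_facts]). *)
Definition pendant {G : sgraph} (B : pred G) (a z : G) : Prop :=
  [/\ ~~ B a, ~~ B z & adj G a z] /\
  [/\ forall u, adj G a u -> ~~ B u -> u = z,
      forall u, adj G (bnbr B a) u -> ~~ B u -> u = a &
      ~~ hasA B (bnbr B (bnbr B a))].

Lemma pendant_A {G : sgraph} (B : pred G) :
  simple G -> acyclic G -> good B -> (exists a, ~~ B a) ->
  exists a z, pendant B a z.
Proof.
move=> sG acG gB [a0 Ba0].
have [z0 az0 Bz0] := notB_nbr gB a0 Ba0.
suff main n a z q : #|G| - size q <= n -> path (adj G) a (z :: q) ->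
    uniq (a :: z :: q) -> ~~ B a -> ~~ B z -> exists a z, pendant B a z.
  apply: (main #|G| a0 z0 [::]); rewrite ?subn0 //=; first by rewrite az0.
  by rewrite inE andbT adj_neq.
have symG u v : adj G u v -> adj G v u by rewrite sG.1.
have nBB u v : ~~ B u -> B v -> u != v by move=> Bu; apply: contraTneq => <-.
have BnB u v : B u -> ~~ B v -> u != v by move=> Bu; apply: contraNneq => <-.
elim: n a z q => [|n IHn] a z q sz pq uq Ba Bz.
  have : (size q).+1 < #|G| by rewrite -(card_uniqP uq : _ = (size q).+2) max_card.
  by move: sz; rewrite leqn0 subn_eq0 => /leq_ltn_trans h /ltnW/h; rewrite ltnn.
have sz' k : #|G| - (size q + k.+1) <= n.
  by rewrite addnS subnS -subn1 leq_subLR add1n (leq_trans _ sz) // leq_sub2l // leq_addr.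
have aB : adj G a (bnbr B a) by apply: adj_bnbr.
have bB : B (bnbr B a) by apply: bnbrB.
have cB : B (bnbr B (bnbr B a)) by apply: bnbrB.
have bc : adj G (bnbr B a) (bnbr B (bnbr B a)) by apply: adj_bnbr.
have [b bE] : exists b, b = bnbr B a by exists (bnbr B a).
have [c cE] : exists c, c = bnbr B b by exists (bnbr B b).
rewrite -bE -?cE in aB bB cB bc; move: aB bB cB bc => ab Bb Bc bc.
have az : adj G a z by case/andP: pq.
have ext w x y (p : seq G) : path (adj G) x (y :: p) -> uniq (x :: y :: p) ->
    adj G x w -> w != y -> path (adj G) w (x :: y :: p) /\ uniq (w :: x :: y :: p).
  move=> px ux xw wy; split; first by rewrite /= (symG _ _ xw) in px *.
  by apply: acyclic_path_extend => //; [exact: symG | rewrite eq_sym adj_neq].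
case: (pickP (fun u => [&& adj G a u, ~~ B u & u != z])) => [u /and3P[au Bu uz]|noA].
  have [pu uu] := ext u _ _ _ pq uq au uz.
  by apply: (IHn u a (z :: q)) => //; have := sz' 0; rewrite addn1.
have [pb ub] := ext b _ _ _ pq uq ab (BnB _ _ Bb Bz).
case: (pickP (fun u => [&& adj G b u, ~~ B u & u != a])) => [u /and3P[bu Bu ua]|nob].
  have [u' uu' Bu'] := notB_nbr gB u Bu.
  have [pu qu] := ext u _ _ _ pb ub bu ua.
  have [pu' qu'] := ext u' _ _ _ pu qu uu' (nBB _ _ Bu' Bb).
  by apply: (IHn u' u [:: b, a, z & q]) => //; have := sz' 2; rewrite addn3.
have [pc uc] := ext c _ _ _ pb ub bc (BnB _ _ Bc Ba).
case: (boolP (hasA B c)) => [/existsP[u /andP[cu Bu]]|noc].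
  have [u' uu' Bu'] := notB_nbr gB u Bu.
  have [pu qu] := ext u _ _ _ pc uc cu (nBB _ _ Bu Bb).
  have [pu' qu'] := ext u' _ _ _ pu qu uu' (nBB _ _ Bu' Bc).
  by apply: (IHn u' u [:: c, b, a, z & q]) => //; have := sz' 3; rewrite addn4.
exists a, z; split=> //; rewrite /pendant -bE -cE; split=> [u au Bu|u bu Bu|//].
  by have := noA u; rewrite au Bu => /negbFE/eqP.
by have := nob u; rewrite bu Bu => /negbFE/eqP.
Qed.

Definition stat {G : sgraph} (B : pred G) (v : G) : status := if B v then SB else SA.

Lemma card_induced {G : sgraph} (S : {set G}) a : a \notin S -> #|induced S| < #|G|.
Proof.
move=> aS; rewrite card_sig -cardsT; apply: proper_card; apply/properP; split.
  by apply/subsetP => v _; rewrite inE.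
by exists a; rewrite ?inE.
Qed.

Section Decompose.
Context {G : sgraph} {B : pred G} {a z : G}.
Hypotheses (tG : is_tree G) (gB : good B) (pend : pendant B a z).
Notation m := (bnbr B).
Notation b := (m a).
Notation c := (m b).
Notation y := (m z).
Notation x := (m y).
Let sG : simple G := tG.1.

Lemma inO_lab_induced (S : {set G}) (r : G -> G) u :
  (forall v, r v \in S) -> (forall v, v \in S -> r v = v) ->
  (forall u v, adj G u v -> r u = r v \/ adj G (r u) (r v)) ->
  (forall v, v \in S -> m v \in S) ->
  (forall v, v \in S -> ~~ B v -> exists u, [/\ u \in S, adj G v u & ~~ B u]) ->
  u \in S -> ~~ B u ->
  (forall (H : sgraph) (D : pred H), #|H| < #|G| -> is_tree H -> good D ->
    (exists u, ~~ D u) -> inO_lab (stat D)) ->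
  (exists w, w \notin S) ->
  inO_lab (stat (fun v : induced S => B (val v))).
Proof.
move=> rS rK radj Sm SA uS Bu IH [w wS]; apply: IH.
- exact: card_induced wS.
- split; first exact: induced_simple.
  split; last by apply: induced_acyclic; exact: tG.2.2.
  by apply: (@induced_connected _ _ r) => // ? ? _ _; exact: tG.2.1.
- exact: induced_good.
- by exists (Sub u uS).
Qed.

Lemma pendant_facts :
  [/\ forall w, adj G a w = (w == b) || (w == z),
      forall w, adj G b w = (w == a) || (w == c),
      forall w, adj G c w = (w == b) &
      uniq [:: x; y; z; a; b; c]].
Proof.
have [[Ba Bz az] [na nb nc]] := pend.
have symG u v : adj G u v -> adj G v u by rewrite sG.1.
have By : B y by apply: bnbrB.
have Bb : B b by apply: bnbrB.
have Na w : adj G a w = (w == b) || (w == z).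
  apply/idP/orP => [aw|[]/eqP-> //]; last exact: adj_bnbr.
  by case: (boolP (B w)) => [/(bnbr_uniq gB _ _ aw)->|/(na _ aw)->]; rewrite eqxx; [left|right].
have Nb w : adj G b w = (w == a) || (w == c).
  apply/idP/orP => [bw|[]/eqP->]; last 2 first.
  - by apply: symG; apply: adj_bnbr.
  - exact: adj_bnbr.
  by case: (boolP (B w)) => [/(bnbr_uniq gB _ _ bw)->|/(nb _ bw)->]; rewrite eqxx; [right|left].
have Nc w : adj G c w = (w == b).
  apply/idP/eqP => [cw|->]; last by apply: symG; apply: adj_bnbr.
  have := existsPn nc w; rewrite cw negbK => /(bnbr_uniq gB _ _ cw) <-.
  by rewrite bnbrK.
split=> //.
have BnA u v : B u -> ~~ B v -> (u == v) = false by move=> Bu; apply: contraNF => /eqP<-.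
have za : (z == a) = false by rewrite eq_sym; apply/negbTE/adj_neq.
have yb : (y == b) = false.
  apply/negP => /eqP E; have := Nb z; rewrite -E symG ?adj_bnbr // za.
  by rewrite eq_sym BnA // E bnbrB.
have yc : (y == c) = false.
  apply/negP => /eqP E; have := Nc z; rewrite -E symG ?adj_bnbr //.
  by rewrite eq_sym BnA.
have xy : (x == y) = false by apply/negbTE/bnbr_neq.
have xb : (x == b) = false.
  by apply/negP => /eqP E; move: yc; rewrite -E bnbrK // eqxx.
have xc : (x == c) = false.
  apply/negP => /eqP E; have := Nc y; rewrite -E symG ?adj_bnbr //.
  by rewrite yb.
have bc : (b == c) = false by rewrite eq_sym; apply/negbTE/bnbr_neq.
rewrite /= !inE xy xb xc yb yc za bc !(eq_sym z) !(eq_sym a) !BnA //; exact: bnbrB.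
Qed.

End Decompose.

Lemma codom_induced {G : sgraph} (S : {set G}) w :
  (w \in codom (val : induced S -> G)) = (w \in S).
Proof.
apply/codomP/idP => [[u ->]|wS]; first exact: (valP u).
by exists (Sub w wS).
Qed.

Lemma induced_embeds {G : sgraph} (S : {set G}) : embeds (val : induced S -> G).
Proof. by split=> //; exact: val_inj. Qed.

Lemma inO_lab_P6 {G : sgraph} (B : pred G) (s : seq G) (v0 : G) :
  simple G -> uniq s -> size s = 6 -> (forall v, v \in s) ->
  (forall i v, i < 6 -> adj G (nth v0 s i) v =
     (0 < i) && (v == nth v0 s i.-1) || (i < 5) && (v == nth v0 s i.+1)) ->
  (forall i, i < 6 -> B (nth v0 s i) = ~~ ((i == 2) || (i == 3))) ->
  inO_lab (stat B).
Proof.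
move=> sG us ss sP sadj sB; apply: (@inO_base _ _ (fun i : 'I_6 => nth v0 s i)) => //.
- apply: bij_of_inj_surj => [i j /eqP|v].
    by rewrite nth_uniq ?ss // => /eqP/val_inj.
  have lt : index v s < 6 by rewrite -ss index_mem.
  by exists (Ordinal lt); rewrite /= nth_index.
- move=> [i lti] [j ltj]; rewrite /= sadj //.
  move: i lti j ltj => [|[|[|[|[|[|//]]]]]] lti [|[|[|[|[|[|//]]]]]] ltj;
    by rewrite /= ?nth_uniq ?ss.
- by move=> i; rewrite /stat sB //; case: (_ || _).
Qed.

Lemma inO_lab_of_good (n : nat) (G : sgraph) (B : pred G) :
  #|G| < n -> is_tree G -> good B -> (exists a, ~~ B a) -> inO_lab (stat B).
Proof.
elim: n G B => // n IHn G B ltGn tG gB exA.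
have [a [z pend]] := pendant_A B tG.1 tG.2.2 gB exA.
have IH (H : sgraph) (D : pred H) : #|H| < #|G| -> is_tree H -> good D ->
    (exists u, ~~ D u) -> inO_lab (stat D).
  by move=> HG; apply: IHn; apply: leq_trans HG _.
have [Na Nb Nc U] := pendant_facts tG gB pend.
have [[Ba Bz az] _] := pend.
have sG := tG.1; have symG := sG.1.
set b := bnbr B a in Na Nb Nc U *.
set c := bnbr B b in Na Nb Nc U *.
set y := bnbr B z in Na Nb Nc U *.
set x := bnbr B y in Na Nb Nc U *.
have Bb : B b by apply: bnbrB.
have Bc : B c by apply: bnbrB.
have By : B y by apply: bnbrB.
have Bx : B x by apply: bnbrB.
have zy : adj G z y by apply: adj_bnbr.
have yx : adj G y x by apply: adj_bnbr.
have [sa sz sb sc] : [/\ stat B a = SA, stat B z = SA, stat B b = SB & stat B c = SB].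
  by rewrite /stat Bb Bc (negPf Ba) (negPf Bz).
have U1 := U; rewrite /= !inE !negb_or in U1.
case/and5P: U1 => /and5P[xy xz xa xb xc] /and4P[yz ya yb yc]
  /and3P[za zb zc] /andP[ab ac] /andP[bc _].
case: (boolP [exists u, [&& adj G z u, ~~ B u & u != a]]) =>
  [/existsP[u /and3P[zu Bu ua]]|/existsPn noz].
  pose S := ~: [set a; b; c].
  have memS w : (w \in S) = (w \notin [:: a; b; c]) by rewrite !inE -!orbA.
  have [zS yS xS] : [/\ z \in S, y \in S & x \in S].
    by rewrite !inE !negb_or za zb zc ya yb yc xa xb xc.
  have toS v w : adj G v w -> v \in S -> w \notin S -> v = z /\ w = a.
    move=> vw; rewrite !memS negbK => vS; rewrite !inE => /or3P[]/eqP wE;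
      move: vw; rewrite symG wE ?Na ?Nb ?Nc.
    + case/orP=> /eqP vE //; by rewrite vE !inE eqxx ?orbT in vS.
    + case/orP=> /eqP vE; by rewrite vE !inE eqxx ?orbT in vS.
    + move=> /eqP vE; by rewrite vE !inE eqxx ?orbT in vS.
  apply: (@inO_op1 (induced S) (stat (fun v : induced S => B (val v))) G (stat B) val
    (Sub x xS) (Sub y yS) (Sub z zS) a b c) => //.
  - apply: (@inO_lab_induced _ _ tG gB S (fun v => if v \in S then v else z) z) => //.
    + by move=> v; case: ifP.
    + by move=> v ->.
    + move=> v w vw; case: ifPn => vS; case: ifPn => wS; [by right | left | left | by left].
        by case: (toS _ _ vw vS wS).
      by rewrite symG in vw; case: (toS _ _ vw wS vS).
    + move=> v vS; apply: contraT => mS.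
      have [_ E] := toS _ _ (adj_bnbr gB v) vS mS.
      by have := bnbrB gB v; rewrite E (negPf Ba).
    + move=> v vS Bv; case: (eqVneq v z) => [->|vz].
        exists u; split=> //; apply: contraT => uS.
        by have [_ E] := toS _ _ zu zS uS; rewrite E eqxx in ua.
      have [w vw Bw] := notB_nbr gB v Bv; exists w; split=> //.
      by apply: contraT => wS; have [E] := toS _ _ vw vS wS; rewrite E eqxx in vz.
    + by exists a; rewrite memS !inE eqxx.
  - exact: induced_embeds.
  - by rewrite -[adj _ _ _]/(adj G x y) symG.
  - by rewrite -[adj _ _ _]/(adj G y z) symG.
  - by rewrite /stat /= Bx.
  - by rewrite /stat /= By.
  - by rewrite /= !inE negb_or ab ac bc.
  - by move=> w; rewrite codom_induced memS negbK.
have Nz w : adj G z w = (w == y) || (w == a).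
  apply/idP/orP => [zw|[]/eqP-> //]; last by rewrite symG.
  case: (boolP (B w)) => [/(bnbr_uniq gB _ _ zw) <-|Bw]; first by left.
  by right; have := noz w; rewrite zw Bw negbK.
pose S := ~: [set a; b; c; z].
have memS w : (w \in S) = (w \notin [:: c; b; a; z]).
  rewrite !inE; congr (~~ _); rewrite -!orbA orbCA [RHS]orbCA; congr (_ || _).
  by rewrite orbCA; congr (_ || _); rewrite orbCA.
have [yS xS] : y \in S /\ x \in S.
  by rewrite !inE !negb_or ya yb yc xa xb xc yz xz.
have toS v w : adj G v w -> v \in S -> w \notin S -> v = y /\ w = z.
  move=> vw; rewrite !memS negbK => vS; rewrite !inE => /or4P[]/eqP wE;
    move: vw; rewrite symG wE ?Na ?Nb ?Nc ?Nz.
  + move=> /eqP vE; by rewrite vE !inE eqxx ?orbT in vS.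
  + case/orP=> /eqP vE; by rewrite vE !inE eqxx ?orbT in vS.
  + case/orP=> /eqP vE; by rewrite vE !inE eqxx ?orbT in vS.
  + case/orP=> /eqP vE //; by rewrite vE !inE eqxx ?orbT in vS.
case: (boolP [exists u, (u \in S) && ~~ B u]) => [/existsP[u /andP[uS Bu]]|/existsPn noS].
  apply: (@inO_op2 (induced S) (stat (fun v : induced S => B (val v))) G (stat B) val
    (Sub y yS) (Sub x xS) c b a z) => //.
  - apply: (@inO_lab_induced _ _ tG gB S (fun v => if v \in S then v else y) u) => //.
    + by move=> v; case: ifP.
    + by move=> v ->.
    + move=> v w vw; case: ifPn => vS; case: ifPn => wS; [by right | left | left | by left].
        by case: (toS _ _ vw vS wS).
      by rewrite symG in vw; case: (toS _ _ vw wS vS).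
    + move=> v vS; apply: contraT => mS.
      have [_ E] := toS _ _ (adj_bnbr gB v) vS mS.
      by have := bnbrB gB v; rewrite E (negPf Bz).
    + move=> v vS Bv; have [w vw Bw] := notB_nbr gB v Bv; exists w; split=> //.
      by apply: contraT => wS; have [E _] := toS _ _ vw vS wS; rewrite E By in Bv.
    + by exists a; rewrite memS !inE eqxx !orbT.
  - exact: induced_embeds.
  - by rewrite /stat /= By.
  - by rewrite /stat /= Bx.
  - rewrite /= !inE !negb_or (eq_sym c) bc (eq_sym c) ac (eq_sym c) zc.
    by rewrite (eq_sym b) ab (eq_sym b) zb (eq_sym a) za.
  - by move=> w; rewrite codom_induced memS negbK.
  - by move=> w; rewrite Nb orbC.
  - by move=> w; rewrite Nz orbC.
have AS v : ~~ B v -> v \in [:: a; z].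
  move=> Bv; have := noS v; rewrite Bv andbT memS negbK !inE => /or4P[]/eqP E;
    by move: Bv; rewrite E ?Bb ?Bc ?eqxx ?orbT.
have Ny w : adj G y w = (w == x) || (w == z).
  apply/idP/orP => [yw|[]/eqP-> //]; last by rewrite symG.
  case: (boolP (B w)) => [/(bnbr_uniq gB _ _ yw) <-|/AS]; first by left.
  rewrite !inE => /orP[] /eqP wE; last by right; rewrite wE.
  by move: yw; rewrite symG wE Na (negPf yb) (negPf yz).
have Nx w : adj G x w = (w == y).
  apply/idP/eqP => [xw|->]; last by rewrite symG.
  case: (boolP (B w)) => [/(bnbr_uniq gB _ _ xw) <-|/AS]; first by rewrite bnbrK.
  rewrite !inE => /orP[] /eqP wE; move: xw; rewrite symG wE ?Na ?Nz.
    by rewrite (negPf xb) (negPf xz).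
  by rewrite (negPf xa) (negPf xy).
apply: (@inO_lab_P6 _ _ [:: x; y; z; a; b; c] x) => //.
- move=> v; rewrite -(@closed_connect _ (adj G) (mem [:: x; y; z; a; b; c]) _ _ _ (tG.2.1 x v)).
    by rewrite !inE eqxx.
  apply: intro_closed; first exact: sym_connect_sym.
  move=> t w tw; rewrite !inE => ts; move: tw.
  by repeat case/orP: ts => ts; rewrite (eqP ts) ?Nx ?Ny ?Nz ?Na ?Nb ?Nc;
    do ?case/orP; move=> ->; rewrite ?orbT.
- move=> [|[|[|[|[|[|//]]]]]] v _ /=; rewrite ?Nx ?Ny ?Nz ?Na ?Nb ?Nc ?orbF // orbC //.
- by move=> [|[|[|[|[|[|//]]]]]] _ /=; rewrite ?Bx ?By ?Bb ?Bc ?(negPf Ba) ?(negPf Bz).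
Qed.

Theorem mainTheorem10 (T : sgraph) :
  is_tree T -> 6 <= #|T| ->
  (inO T <->
   (inO' T \/
    exists M : {set {set T}},
      matching M /\ forall x : minus_plus M, inO' (component x))).
Proof.
move=> tT T6; have T2 : 2 < #|T| by apply: leq_trans T6.
split=> [[lab labO]|TO'].
  have gB := inO_lab_good T lab labO; right.
  exists (inner_matching (B := fun v => isB (lab v))); split.
    exact: matching_inner_matching.
  exact: component_split_inO'.
suff [B gB] : exists B : pred T, good B.
  exists (stat B); apply: (inO_lab_of_good #|T|.+1) => //.
  exact: exists_notB tT.1 tT.2.1 gB T2.
case: TO' => [/inO'_good//|[M [mM cO]]].
have [D gD] := good_of_components (minus_plus_simple M tT.1) cO.
by exists (fun v => D (inl v)); apply: good_minus_plus tT.1 D mM gD.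
Qed.
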